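(* Let $G=PGL_{n+1}$, where $n=p^r-1$ for some $r\ge1$ and a prime $p$. Let $P$ be the standard parabolic subgroup of type $\mathrm A_{n-1}$ (so $G/P\simeq\mathbb P^n$). Then the $D$-module $D_P^\star$ is indecomposable over $\mathbb Z$ (and over $\mathbb Z/p\mathbb Z$), i.e. for $R=\mathbb Z$ (and for $R=\mathbb Z/p\mathbb Z$).
   Context: Chow theory with coefficient ring $R$. $T^*$ is the character lattice of the split maximal torus $T$ of $G$; here it is the root lattice with basis the simple roots $\alpha_1,\dots,\alpha_n$ of the root system $\Sigma$ of type $\mathrm A_n$; $W=\langle s_1,\dots,s_n\rangle$ is the Weyl group and $W_P=\langle s_2,\dots,s_n\rangle$. $W^P$ is the set of minimal length representatives of $W/W_P$; for $w\in W$, $\overline w\in W^P$ is the minimal representative of $wW_P$. $S=\mathrm{Sym}_R(T^* )$ is the polynomial ring with its $W$-action, $Q$ is the localization of $S$ at all roots, and $Q_W$ is the twisted group algebra: the free left $Q$-module on $\delta_w$, $w\in W$, with $(q\delta_w)(q'\delta_{w'})=q\,w(q')\delta_{ww'}$. $D\subset Q_W$ is the subalgebra generated by $S$ and all $X_\alpha=\alpha^{-1}(1-\delta_{s_\alpha})$, $\alpha\in\Sigma$ (the nil affine Hecke algebra). $Q_{W/W_P}$ is the free $Q$-module on $\{\delta_w\}_{w\in W^P}$; $p\colon Q_W\to Q_{W/W_P}$, $q\delta_w\mapsto q\delta_{\overline w}$; $D_P=p(D)$. $Q_{W/W_P}^*=\mathrm{Hom}_Q(Q_{W/W_P},Q)$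 has dual basis $\{f_w\}_{w\in W^P}$, and $D_P^\star=\mathrm{Hom}_S(D_P,S)=\{f\in Q_{W/W_P}^*: f(D_P)\subset S\}$, a $D$-module via the restriction of the $\odot$-action $q\delta_w\odot q'f_v=q\,w(q')f_{\overline{wv}}$ ($q,q'\in Q$, $w\in W$, $v\in W^P$) of $Q_W$ on $Q_{W/W_P}^*$. Indecomposable means that $\mathrm{End}_D(D_P^\star)$ has no non-trivial idempotents. *)

(* Defs.v *)
From HB Require Import structures.
From mathcomp Require Import all_boot all_order all_algebra all_fingroup.
From mathcomp Require Import generic_quotient fraction.
From mathcomp Require Import mpoly.

Set Implicit Arguments.
Unset Strict Implicit.
Unset Printing Implicit Defensive.

Import GRing.Theory.
Local Open Scope ring_scope.

(* The root system of type A_n is {e_i - e_j | i <> j} in Z^(n+1), and its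
   Weyl group W is 'S_n.+1.  Indices start at 0: alpha_(k+1) = e_k - e_(k+1)
   and s_(k+1) = simple_refl k for k : 'I_n. *)
Section WeylGroup.

Variable n : nat.

Definition simple_refl (k : 'I_n) : 'S_n.+1 :=
  tperm (widen_ord (leqnSn n) k) (lift ord0 k).

Lemma gen_simple_refl :
  <<[set simple_refl k | k : 'I_n]>>%g = [set: 'S_n.+1].
Proof.
apply/eqP; rewrite eqEsubset subsetT /= -(gen_tperm (ord0 : 'I_n.+1)) gen_subG.
apply/subsetP => _ /imsetP[[y ltyn] _ ->].
elim: y ltyn => [|y IHy] ltyn.
  have -> : Ordinal ltyn = ord0 by apply: val_inj.
  by rewrite tperm1 group1.
have ltyn' : (y < n)%N by [].
have lty : (y < n.+1)%N by apply: ltnW.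
set k := Ordinal ltyn'.
have sk : simple_refl k \in <<[set simple_refl k | k : 'I_n]>>%g.
  by rewrite mem_gen ?imset_f.
have ey : widen_ord (leqnSn n) k = Ordinal lty by apply: val_inj.
have ey1 : lift ord0 k = Ordinal ltyn by apply: val_inj.
have [y0 | y0] := posnP y.
  have -> : (ord0 : 'I_n.+1) = Ordinal lty by apply: val_inj; rewrite /= y0.
  by rewrite -ey -ey1.
have := groupJ (IHy lty) sk.
rewrite tpermJ /simple_refl ey ey1 tpermL tpermD //.
  by rewrite -val_eqE /= -lt0n.
Qed.

Lemma word_exists (w : 'S_n.+1) :
  exists l, [exists t : l.-tuple 'I_n, w == \prod_(k <- t) simple_refl k]%g.
Proof.
have : w \in <<[set simple_refl k | k : 'I_n]>>%g.
  by rewrite gen_simple_refl inE.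
case/gen_prodgP => l [c cA ->]; exists l.
have {}cA i : exists k, c i == simple_refl k.
  by have /imsetP[k _ ->] := cA i; exists k.
apply/existsP; exists [tuple xchoose (cA i) | i < l].
rewrite big_tuple; apply/eqP/eq_bigr => i _.
by rewrite tnth_mktuple; apply/eqP; apply: (xchooseP (cA i)).
Qed.

Definition coxeter_length (w : 'S_n.+1) : nat := ex_minn (word_exists w).

Definition W_P : {group 'S_n.+1} :=
  <<[set simple_refl k | k : 'I_n & val k != 0%N]>>%G.

Definition min_reps : {set 'S_n.+1} :=
  [set w | [forall u in W_P, coxeter_length w <= coxeter_length (w * u)%g]%N].

Definition WP_quot := {w : 'S_n.+1 | w \in min_reps}.

Definition min_rep_val (w : 'S_n.+1) : 'S_n.+1 :=
  [arg min_(v < w in (w *: W_P)%g) coxeter_length v].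

Lemma min_repP w : min_rep_val w \in min_reps.
Proof.
rewrite /min_rep_val; case: arg_minnP => [|v]; first exact: lcoset_refl.
move=> vw vmin; rewrite inE; apply/forall_inP => u uP; apply: vmin.
by rewrite mem_lcoset mulgA groupM // -mem_lcoset.
Qed.

Definition min_rep (w : 'S_n.+1) : WP_quot := Sub (min_rep_val w) (min_repP w).

End WeylGroup.

Section Indecomposability.

Variables (R : idomainType) (n : nat).

Local Notation W := 'S_n.+1.

(* 'X_k is the simple root alpha_(k+1). *)
Local Notation S := {mpoly R[n]}.

(* e_i - e_j in terms of the simple roots. *)
Definition root_elt (i j : 'I_n.+1) : S :=
  \sum_(k < n | (i <= k < j)%N) 'X_k - \sum_(k < n | (j <= k < i)%N) 'X_k.

(* Since (s * t)%g x = t (s x), a left action is e_i |-> e_(w^-1 i). *)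
Definition actS (w : W) (a : S) : S :=
  a \mPo [tuple root_elt (w^-1%g (widen_ord (leqnSn n) k)) (w^-1%g (lift ord0 k))
         | k < n].

(* S is a domain and roots are nonzero, so Q is a subring of Frac(S). *)
Local Notation F := {fraction S}.
Local Notation toF := (@tofrac S).

Definition inS (x : F) : Prop := exists a : S, x = toF a.

Definition inQ (x : F) : Prop :=
  exists (a : S) (l : seq ('I_n.+1 * 'I_n.+1)),
    all (fun ij => ij.1 != ij.2) l /\
    x = toF a / toF (\prod_(ij <- l) root_elt ij.1 ij.2).

Definition actF (w : W) (x : F) : F :=
  toF (actS w (\n_(repr x))) / toF (actS w (\d_(repr x))).

(* z w is the coefficient of delta_w; Q_W consists of the z with values in Q. *)
Definition QW := {ffun W -> F}.

Definition QW_delta (q : F) (w : W) : QW := [ffun u => if u == w then q else 0].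

Definition QW_mul (y z : QW) : QW :=
  [ffun u => \sum_(v : W) \sum_(w : W | (v * w)%g == u) y v * actF v (z w)].

(* The reflection in the root e_i - e_j is tperm i j. *)
Definition X_root (i j : 'I_n.+1) : QW :=
  QW_mul (QW_delta (toF (root_elt i j))^-1 1%g)
         (QW_delta 1 1%g - QW_delta 1 (tperm i j)).

Inductive inD : QW -> Prop :=
| inD_S (a : S) : inD (QW_delta (toF a) 1%g)
| inD_X (i j : 'I_n.+1) : i != j -> inD (X_root i j)
| inD_add y z : inD y -> inD z -> inD (y + z)
| inD_mul y z : inD y -> inD z -> inD (QW_mul y z).

Definition QWP := {ffun WP_quot n -> F}.

Definition proj (z : QW) : QWP := [ffun v => \sum_(w : W | min_rep w == v) z w].

Definition inDP (d : QWP) : Prop := exists2 z : QW, inD z & d = proj z.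

(* f v is the coefficient of f_v, i.e. the value at delta_v. *)
Definition QWP_dual := {ffun WP_quot n -> F}.

Definition pairing (f : QWP_dual) (d : QWP) : F := \sum_v d v * f v.

Definition inDPstar (f : QWP_dual) : Prop :=
  (forall v, inQ (f v)) /\ (forall d, inDP d -> inS (pairing f d)).

Definition odot (z : QW) (f : QWP_dual) : QWP_dual :=
  [ffun u => \sum_(w : W) \sum_(v | min_rep (w * val v)%g == u)
               z w * actF w (f v)].

(* Only the values of e on D_P^star matter. *)
Definition DPstar_endomorphism (e : QWP_dual -> QWP_dual) : Prop :=
  [/\ forall f, inDPstar f -> inDPstar (e f),
      forall f g, inDPstar f -> inDPstar g -> e (f + g) = e f + e g &
      forall z f, inD z -> inDPstar f -> e (odot z f) = odot z (e f)].

Definition DPstar_indecomposable : Prop :=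
  forall e : QWP_dual -> QWP_dual,
    DPstar_endomorphism e ->
    (forall f, inDPstar f -> e (e f) = e f) ->
    (forall f, inDPstar f -> e f = 0) \/ (forall f, inDPstar f -> e f = f).

End Indecomposability.

(* Main.v *)
From HB Require Import structures.
Require Import Defs.
From mathcomp Require Import all_boot all_order all_algebra all_fingroup.
From mathcomp Require Import all_field generic_quotient fraction mpoly.
From mathcomp Require Import zify ring.

(** Write x_i for the weights, so that roots are the differences x_i - x_j and
    the cosets of W_P are the indices 0..n, that is, the T-fixed points of P^n.
    Elements of D_P^* are then functions of i.

    The point classes pt_j, equal to e_j = prod_(l <> j) (x_j - x_l) at j and
    to 0 elsewhere, belong to D_P^* ([point_class_DPstar]) and span it over Q.
    A D-linear endomorphism is therefore given by a square matrix M of size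
    n + 1 with entries in Q ([endo_mxE], [endo_mx_inQ]), and it commutes with
    the elements delta_w of D, so M (w i) (w j) = w (M i j)
    ([endo_mx_equivariant]); here w i is the index of the weight w (x_i), that
    is, the image of i under the permutation w^-1.  An idempotent endomorphism
    gives M^2 = M.

    Since n + 1 = p^r, the n + 1 coordinates x_i can be specialised to the
    p^r elements of the field k with p^r elements.  Roots go to differences of
    distinct elements, hence to units, so this is a k-point of Spec Q and M
    reduces there to a matrix Y over k with Y^2 = Y.  A translation
    t |-> t + d of k is a permutation of the coordinates that changes no
    difference x_i - x_j, so the corresponding w in W fixes this point, and the
    equivariance of M becomes invariance: Y (w i) (w j) = Y i j.  Hence Y is a
    combination of the permutation matrices of the translations, that is, an
    element of the group algebra k[k, +].  This algebra is commutative of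
    characteristic p, and its group has exponent p, so the p-th power of any
    element is a scalar; as Y = Y^p, the idempotent Y is 0 or 1
    ([circulant_idempotent]).  Finally an idempotent matrix over Frac(S) that
    reduces to 0 or 1 is itself 0 or 1, because det (1 - M), respectively
    det M, has a nonzero residue ([idempotent_of_residue]).

    The ring R enters only through a ring morphism R -> k, which exists both
    for the integers and for F_p. *)

Set Implicit Arguments.
Unset Strict Implicit.
Unset Printing Implicit Defensive.

Import GRing.Theory.

(** * Cosets of W_P *)

Section Cosets.

Variable n : nat.
Local Notation W := 'S_n.+1.
Implicit Types (w u : W) (t : seq 'I_n).

Lemma W_P_fix0 u : u \in W_P n -> u ord0 = ord0.
Proof.
move=> uP; suff /subsetP/(_ u uP) : W_P n \subset 'C[ord0 | 'P]%g.
  by move/astab1P.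
rewrite gen_subG; apply/subsetP => _ /imsetP[k kn0 ->].
rewrite inE in kn0; apply/astab1P; rewrite /= /aperm tpermD // -val_eqE /=.
Qed.

Lemma fix0_lift_perm m (u : 'S_m.+1) :
  u ord0 = ord0 -> exists s : 'S_m, u = lift_perm ord0 ord0 s.
Proof.
move=> u0; pose f k := odflt k (unlift ord0 (u (lift ord0 k))).
have fE k : lift ord0 (f k) = u (lift ord0 k).
  rewrite /f; case: unliftP => [j -> //|/eqP].
  by rewrite -{2}u0 (inj_eq perm_inj) eq_sym (negPf (neq_lift _ _)).
have f_inj : injective f.
  by move=> i j /(congr1 (lift ord0)); rewrite !fE => /perm_inj/lift_inj.
exists (perm f_inj); apply/permP => i.
case: (unliftP ord0 i) => [k ->|->]; first by rewrite lift_perm_lift permE fE.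
by rewrite lift_perm_id u0.
Qed.

Lemma lift_simple_refl m (k : 'I_m) :
  lift_perm ord0 ord0 (simple_refl k) = simple_refl (lift ord0 k).
Proof.
apply/permP => i; case: (unliftP ord0 i) => [j ->|->].
  rewrite lift_perm_lift /simple_refl.
  have e1 : widen_ord (leqnSn m.+1) (lift ord0 k)
          = lift ord0 (widen_ord (leqnSn m) k) by apply: val_inj.
  by rewrite e1 (inj_tperm _ _ _ lift_inj).
by rewrite lift_perm_id tpermD // -val_eqE.
Qed.

(** The stabiliser of 0 is a symmetric group on the other indices, and lifting
    takes its simple reflections to those of W_P. *)
Lemma fix0_W_P u : u ord0 = ord0 -> u \in W_P n.
Proof.
move=> /fix0_lift_perm[]; case: n u => [|m] u s ->.
  by rewrite [lift_perm _ _ _](_ : _ = 1%g) ?group1 //;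
     apply/permP => i; rewrite !ord1.
have : s \in <<[set simple_refl k | k : 'I_m]>>%g.
  by rewrite gen_simple_refl inE.
case/gen_prodgP => l [c cA ->].
have -> : lift_perm ord0 ord0 (\prod_(i < l) c i)%g
        = (\prod_(i < l) lift_perm ord0 ord0 (c i))%g.
  apply: (big_morph (lift_perm ord0 ord0)) => [x y|]; last exact: lift_perm1.
  by rewrite lift_permM.
apply: group_prod => i _; have /imsetP[k _ ->] := cA i.
by rewrite lift_simple_refl mem_gen // imset_f // inE.
Qed.

Local Notation word t := (\prod_(k <- t) simple_refl k)%g.

Lemma word_cons k t (j : 'I_n.+1) : word (k :: t) j = word t (simple_refl k j).
Proof. by rewrite big_cons permM. Qed.

(** A simple reflection lowers an index by at most one, and only its own upper
    index.  So a word taking j to 0 has at least j letters, and one with exactly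
    j letters is forced letter by letter: this is why each coset of W_P has a
    single element of minimal length. *)
Lemma simple_refl_val (k : 'I_n) (j : 'I_n.+1) :
  (j <= (simple_refl k j).+1)%N /\
  (j = (simple_refl k j).+1 :> nat -> j = k.+1 :> nat).
Proof.
rewrite /simple_refl; case: tpermP => [->|->|_ _] /=;
  rewrite ?/bump /= ?add1n; split; try lia.
Qed.

Lemma word_size_ge t (j : 'I_n.+1) : word t j = ord0 -> (j <= size t)%N.
Proof.
elim: t j => [|k t IHt] j; first by rewrite big_nil perm1 => ->.
rewrite word_cons => /IHt le_t; have [le_j _] := simple_refl_val k j.
exact: leq_trans le_j _.
Qed.

Lemma shortest_word_uniq t1 t2 (j : 'I_n.+1) :
  word t1 j = ord0 -> word t2 j = ord0 -> size t1 = j -> size t2 = j ->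
  t1 = t2.
Proof.
elim: t1 t2 j => [|k1 t1 IHt] [|k2 t2] j //=; try by move=> _ _ <-.
rewrite !word_cons => h1 h2 s1 s2.
have [le1 eq1] := simple_refl_val k1 j; have [le2 eq2] := simple_refl_val k2 j.
have l1 := word_size_ge h1; have l2 := word_size_ge h2.
have j1 : j = (simple_refl k1 j).+1 :> nat by lia.
have j2 : j = (simple_refl k2 j).+1 :> nat by lia.
have ek : k1 = k2 by apply: ord_inj; have := eq1 j1; have := eq2 j2; lia.
subst k2; congr (_ :: _); apply: IHt h1 h2 _ _; lia.
Qed.

Lemma shortest_word_exists (j : 'I_n.+1) :
  exists2 t, word t j = ord0 & size t = j.
Proof.
case: j; elim=> [|j IHj] lt_j.
  by exists [::] => //; rewrite big_nil perm1; apply: val_inj.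
have [t tj st] := IHj (ltnW lt_j); exists (Ordinal (lt_j : j < n)%N :: t) => /=.
  rewrite word_cons -tj; congr (word t _).
  rewrite /simple_refl.
  rewrite [X in tperm _ _ X](_ : _ = lift ord0 (Ordinal (lt_j : j < n)%N)).
    by rewrite tpermR; apply: val_inj.
  exact: val_inj.
by rewrite st.
Qed.

Lemma coxeter_length_word w : exists2 t, word t = w & size t = coxeter_length w.
Proof.
rewrite /coxeter_length; case: ex_minnP => l /existsP[t /eqP ->] _.
by exists t => //; rewrite size_tuple.
Qed.

Lemma coxeter_length_le t : (coxeter_length (word t) <= size t)%N.
Proof.
rewrite /coxeter_length; case: ex_minnP => l _; apply; apply/existsP.
by exists (in_tuple t).
Qed.

(** W_P is the stabiliser of 0, and (w * u)^-1 sends 0 to w^-1 (u^-1 0), so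
    w^-1 0 depends only on w W_P; it names the fixed point of weight w (x_0). *)
Definition coset_index (v : WP_quot n) : 'I_n.+1 := (val v)^-1%g ord0.

(** An element of [WP_quot] of index j has length j, that of a shortest word
    taking j to 0, since multiplying by W_P cannot shorten it; such a word is
    unique. *)
Lemma coset_index_inj : injective coset_index.
Proof.
have shortest (v : WP_quot n) :
    exists t, [/\ word t = val v, word t (coset_index v) = ord0
                & size t = coset_index v].
  have [t0 t0j st0] := shortest_word_exists (coset_index v).
  have [t tv st] := coxeter_length_word (val v).
  have tj : word t (coset_index v) = ord0 by rewrite tv permKV.
  exists t; split=> //; apply/eqP; rewrite eqn_leq word_size_ge // andbT -st0.
  rewrite st; apply: leq_trans (coxeter_length_le t0).
  have := valP v; rewrite inE => /forall_inP /(_ ((val v)^-1 * word t0)%g).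
  by rewrite mulKVg; apply; apply: fix0_W_P; rewrite permM.
move=> v1 v2 ej; have [t1 [v1E t1j st1]] := shortest v1.
have [t2 [v2E t2j st2]] := shortest v2.
apply: val_inj; rewrite -v1E -v2E.
by rewrite -ej in t2j st2; rewrite (shortest_word_uniq t1j t2j).
Qed.

Lemma coset_index_min_rep w : coset_index (min_rep w) = w^-1%g ord0.
Proof.
rewrite /coset_index /= /min_rep_val.
case: arg_minnP => [|v]; first exact: lcoset_refl.
by case/lcosetP => u uP -> _; rewrite invMg permM (W_P_fix0 (groupVr uP)).
Qed.

Definition coset_of_index (j : 'I_n.+1) : WP_quot n := min_rep (tperm ord0 j).

Lemma coset_of_indexK : cancel coset_of_index coset_index.
Proof. by move=> j; rewrite coset_index_min_rep tpermV tpermL. Qed.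

Lemma coset_indexK : cancel coset_index coset_of_index.
Proof. by move=> v; apply: coset_index_inj; rewrite coset_of_indexK. Qed.

Lemma min_rep_eq w v : (min_rep w == v) = (w^-1%g ord0 == coset_index v).
Proof. by rewrite -(inj_eq coset_index_inj) coset_index_min_rep. Qed.

End Cosets.

(** * The Weyl group action on S and on its fraction field *)

Section Actions.

Variables (R : idomainType) (n : nat).
Local Notation W := 'S_n.+1.
Local Notation S := {mpoly R[n]}.
Local Notation F := {fraction S}.
Local Notation toF := (@tofrac S).
Implicit Types (i j k l : 'I_n.+1) (u v w : W) (a b s : S) (x y : F).

Local Open Scope ring_scope.

Local Notation root i j := (root_elt R i j).

Lemma root_eltE i j :
  root i j = \sum_(m < n | (i <= m)%N) 'X_m - \sum_(m < n | (j <= m)%N) 'X_m.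
Proof.
have split_at (i1 j1 : 'I_n.+1) :
    \sum_(m < n | (i1 <= m)%N) 'X_m
    = \sum_(m < n | (i1 <= m < j1)%N) 'X_m
      + \sum_(m < n | ((i1 <= m) && (j1 <= m))%N) 'X_m :> S.
  rewrite (bigID (fun m : 'I_n => (m < j1)%N)) /=; congr (_ + _).
  by apply: eq_bigl => m; rewrite -leqNgt.
rewrite /root_elt (split_at i j) (split_at j i).
have -> : \sum_(m < n | ((j <= m) && (i <= m))%N) 'X_m
    = \sum_(m < n | ((i <= m) && (j <= m))%N) 'X_m :> S.
  by apply: eq_bigl => m; rewrite andbC.
by rewrite opprD addrACA subrr addr0.
Qed.

Lemma root_elt_chain j i k : root i k = root i j + root j k.
Proof. by rewrite !root_eltE; ring. Qed.

Lemma root_elt_ii i : root i i = 0.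
Proof. by rewrite root_eltE subrr. Qed.

Lemma root_eltN i j : - root i j = root j i.
Proof. by rewrite !root_eltE opprB. Qed.

Lemma root_eltB l i j : root i l - root j l = root i j.
Proof. by rewrite !root_eltE; ring. Qed.

Lemma root_elt_simple (m : 'I_n) :
  root (widen_ord (leqnSn n) m) (lift ord0 m) = 'X_m.
Proof.
rewrite /root_elt /= /bump /= add1n [X in _ - X]big_pred0 ?subr0 => [|k].
  2: lia.
by rewrite (big_pred1 m) // => k; rewrite /= -val_eqE /=; lia.
Qed.

(** An additive map out of S that takes differences of consecutive coordinates
    on simple roots does so on every root.  It serves for the Weyl group action
    and for the specialisation of the x_i. *)
Lemma root_elt_morph (A : zmodType) (f : {additive S -> A}) (c : 'I_n.+1 -> A) :
  (forall m : 'I_n,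
     f 'X_m = c (widen_ord (leqnSn n) m) - c (lift ord0 m)) ->
  forall i j, f (root i j) = c i - c j.
Proof.
move=> fX; have f0 i : f (root ord0 i) = c ord0 - c i.
  case: i; elim=> [|i IHi] lt_i.
    rewrite (_ : Ordinal _ = ord0) ?root_elt_ii ?raddf0 ?subrr //.
    exact: val_inj.
  have lt_i' : (i < n)%N by [].
  rewrite (root_elt_chain (Ordinal (ltnW lt_i))) raddfD IHi.
  have -> : Ordinal lt_i = lift ord0 (Ordinal lt_i') by apply: val_inj.
  have -> : Ordinal (ltnW lt_i) = widen_ord (leqnSn n) (Ordinal lt_i').
    exact: val_inj.
  by rewrite root_elt_simple fX addrA subrK.
move=> i j; rewrite (root_elt_chain ord0) raddfD -(root_eltN ord0) raddfN !f0.
by rewrite opprB addrA subrK.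
Qed.

(** S is generated as a ring by constants and simple roots. *)
Lemma mpoly_induction (P : S -> Prop) :
  (forall c, P c%:MP) -> (forall m, P 'X_m) ->
  (forall a b, P a -> P b -> P (a + b)) ->
  (forall a b, P a -> P b -> P (a * b)) -> forall a, P a.
Proof.
move=> PC PX PD PM a; rewrite (mpolyE a).
apply: big_ind => [||m _]; [by rewrite -mpolyC0 | exact: PD |].
rewrite -mul_mpolyC; apply: (PM); first exact: PC.
rewrite mpolyXE_id; apply: big_ind => [||k _].
- by rewrite -mpolyC1.
- exact: PM.
elim: (m k) => [|d IHd]; first by rewrite expr0 -mpolyC1.
by rewrite exprS; apply: PM.
Qed.

Lemma actS_is_zmod_morphism w : zmod_morphism (@actS R n w).
Proof. by move=> a b; rewrite /actS raddfB. Qed.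
Lemma actS_is_monoid_morphism w : monoid_morphism (@actS R n w).
Proof. by split=> [|a b]; rewrite /actS ?comp_mpoly1 ?rmorphM. Qed.

HB.instance Definition _ w :=
  GRing.isZmodMorphism.Build S S (@actS R n w) (actS_is_zmod_morphism w).
HB.instance Definition _ w :=
  GRing.isMonoidMorphism.Build S S (@actS R n w) (actS_is_monoid_morphism w).

Lemma actSC w c : actS w c%:MP = c%:MP :> S.
Proof. exact: comp_mpolyC. Qed.

Lemma actS_root w i j : actS w (root i j) = root (w^-1%g i) (w^-1%g j).
Proof.
pose c i := root (w^-1%g i) ord0.
rewrite (@root_elt_morph _ (actS w) c) => [|m]; first exact: root_eltB.
  by rewrite /= /actS comp_mpolyXU -tnth_nth tnth_mktuple root_eltB.
Qed.

Lemma actSX w (m : 'I_n) : actS w 'X_m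
  = root (w^-1%g (widen_ord (leqnSn n) m)) (w^-1%g (lift ord0 m)).
Proof. by rewrite -root_elt_simple actS_root. Qed.

Lemma actSM u w a : actS (u * w)%g a = actS u (actS w a).
Proof.
elim/mpoly_induction: a => [c|m|a b IHa IHb|a b IHa IHb].
- by rewrite !actSC.
- by rewrite -root_elt_simple !actS_root invMg !permM.
- by rewrite !rmorphD /= IHa IHb.
- by rewrite !rmorphM /= IHa IHb.
Qed.

Lemma actS1 a : actS 1%g a = a.
Proof.
elim/mpoly_induction: a => [c|m|a b IHa IHb|a b IHa IHb].
- by rewrite actSC.
- by rewrite -root_elt_simple actS_root invg1 !perm1.
- by rewrite rmorphD /= IHa IHb.
- by rewrite rmorphM /= IHa IHb.
Qed.

Lemma actSK w : cancel (@actS R n w) (@actS R n w^-1).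
Proof. by move=> a; rewrite -actSM mulVg actS1. Qed.

Lemma actS_eq0 w a : (actS w a == 0) = (a == 0).
Proof. by rewrite -{1}(rmorph0 (actS w)) (inj_eq (can_inj (actSK w))). Qed.

(** W is 2-transitive on indices, so every root is conjugate to a simple one. *)
Lemma root_elt_neq0 i j : i != j -> root i j != 0.
Proof.
move=> ij; have n_gt0 : (0 < n)%N.
  by move: i j ij; case: n => // i j; rewrite !ord1 eqxx.
pose m := Ordinal n_gt0.
pose i0 := widen_ord (leqnSn n) m; pose j0 := lift ord0 m.
have ij0 : i0 != j0 by rewrite -val_eqE.
have [w wi wj] : exists2 w : W, w^-1%g i0 = i & w^-1%g j0 = j.
  pose u := (tperm i i0 * tperm (tperm i i0 j) j0)%g.
  have ui : u i = i0.
    rewrite permM tpermL tpermD 1?eq_sym //.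
    by rewrite -{1}(tpermL i i0) (inj_eq perm_inj).
  have uj : u j = j0 by rewrite permM tpermL.
  by exists u; rewrite -?ui -?uj permK.
rewrite -wi -wj -actS_root actS_eq0 root_elt_simple.
by rewrite -msize_poly_eq0 msizeX mdeg1.
Qed.

(** The action on fractions is defined on chosen representatives; this and
    [actF_frac] make every representation of a fraction usable. *)
Lemma fractionE x : x = toF \n_(repr x) / toF \d_(repr x).
Proof.
have d0 : \d_(repr x) != 0 by exact: denom_ratioP.
have dF0 : toF \d_(repr x) != 0 by rewrite tofrac_eq0.
rewrite -[LHS](mulfK dF0); congr (_ / _).
rewrite -{1}(reprK x); unlock tofrac; rewrite -[LHS]FracField.pi_mul.
apply/eqmodP => /=; rewrite /FracField.equivf /FracField.mulf /=.
by rewrite !numden_Ratio ?(oner_eq0, mulr1, mulf_neq0) // mulrC.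
Qed.

Lemma fractionP x : exists a b, b != 0 /\ x = toF a / toF b.
Proof.
exists \n_(repr x), \d_(repr x); split; last exact: fractionE.
exact: denom_ratioP.
Qed.

Lemma actF_frac w a b :
  b != 0 -> actF w (toF a / toF b) = toF (actS w a) / toF (actS w b).
Proof.
move=> b0; rewrite /actF; set x := toF a / toF b.
have d0 := denom_ratioP (repr x).
have := fractionE x; rewrite {1}/x => /eqP.
rewrite eqr_div ?tofrac_eq0 // -!rmorphM tofrac_eq => /eqP e.
apply/eqP; rewrite eqr_div ?tofrac_eq0 ?actS_eq0 // -!rmorphM tofrac_eq.
by rewrite e.
Qed.

Lemma actF_toF w a : actF w (toF a) = toF (actS w a).
Proof.
by rewrite -[toF a]divr1 -tofrac1 actF_frac ?oner_eq0 // rmorph1 tofrac1 divr1.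
Qed.

Lemma actF_is_zmod_morphism w : zmod_morphism (@actF R n w).
Proof.
move=> x y; have [a [b [b0 ->]]] := fractionP x.
have [c [d [d0 ->]]] := fractionP y.
have -> : toF a / toF b - toF c / toF d = toF (a * d - c * b) / toF (b * d).
  rewrite rmorphB !rmorphM /= -[- (toF c / _)]mulNr.
  by rewrite addf_div ?tofrac_eq0 // mulNr.
rewrite !actF_frac ?mulf_neq0 // !(rmorphB, rmorphM) /=.
by rewrite -[- (_ / _)]mulNr addf_div ?tofrac_eq0 ?actS_eq0 // mulNr.
Qed.

Lemma actF_is_monoid_morphism w : monoid_morphism (@actF R n w).
Proof.
split=> [|x y]; first by rewrite -tofrac1 actF_toF rmorph1.
have [a [b [b0 ->]]] := fractionP x; have [c [d [d0 ->]]] := fractionP y.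
by rewrite mulf_div -!rmorphM !actF_frac ?mulf_neq0 // !rmorphM mulf_div.
Qed.

HB.instance Definition _ w :=
  GRing.isZmodMorphism.Build F F (@actF R n w) (actF_is_zmod_morphism w).
HB.instance Definition _ w :=
  GRing.isMonoidMorphism.Build F F (@actF R n w) (actF_is_monoid_morphism w).

Lemma actFM u w x : actF (u * w)%g x = actF u (actF w x).
Proof.
have [a [b [b0 ->]]] := fractionP x.
by rewrite !actF_frac ?actS_eq0 // !actSM.
Qed.

Lemma actF1 x : actF 1%g x = x.
Proof. by have [a [b [b0 ->]]] := fractionP x; rewrite actF_frac // !actS1. Qed.

End Actions.

(** * Tautological functions and point classes *)

Section Module.

Variables (R : idomainType) (n : nat).
Local Notation W := 'S_n.+1.
Local Notation S := {mpoly R[n]}.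
Local Notation F := {fraction S}.
Local Notation toF := (@tofrac S).
Local Notation root i j := (root_elt R i j).
Local Notation QW := (QW R n).
Local Notation QWP_dual := (QWP_dual R n).
Implicit Types (i j k l : 'I_n.+1) (u v w : W) (a b s : S) (x y q : F).
Implicit Types (g h : W -> F) (z : QW) (f : QWP_dual).

Local Open Scope ring_scope.

(** The right-translation action of Q_W on functions on W, for which delta_w
    moves u to u w.  Unlike the pairing on cosets, it is multiplicative in z
    ([QW_evalM]), so that integrality on D can be checked on generators; the
    pairing is its value at 1 ([pairing_proj]). *)
Definition QW_eval z g u : F := \sum_w actF u (z w) * g (u * w)%g.

Lemma QW_evalD z1 z2 g u :
  QW_eval (z1 + z2) g u = QW_eval z1 g u + QW_eval z2 g u.
Proof.
rewrite /QW_eval -big_split; apply: eq_bigr => w _.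
by rewrite ffunE rmorphD mulrDl.
Qed.

Lemma QW_evalB z1 z2 g u :
  QW_eval (z1 - z2) g u = QW_eval z1 g u - QW_eval z2 g u.
Proof.
rewrite /QW_eval -sumrB; apply: eq_bigr => w _.
by rewrite !ffunE rmorphB mulrBl.
Qed.

Lemma QW_eval_delta q w g u :
  QW_eval (QW_delta q w) g u = actF u q * g (u * w)%g.
Proof.
rewrite /QW_eval (bigD1 w) //= ffunE eqxx big1 ?addr0 // => v vw.
by rewrite ffunE (negPf vw) rmorph0 mul0r.
Qed.

Lemma QW_evalM z1 z2 g : QW_eval (QW_mul z1 z2) g =1 QW_eval z1 (QW_eval z2 g).
Proof.
move=> u; rewrite /QW_eval.
transitivity (\sum_t \sum_v \sum_(w | (v * w)%g == t)
    actF u (z1 v) * actF (u * v)%g (z2 w) * g (u * v * w)%g).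
  apply: eq_bigr => t _; rewrite ffunE rmorph_sum big_distrl.
  apply: eq_bigr => v _.
  rewrite rmorph_sum big_distrl; apply: eq_bigr => w /eqP <-.
  by rewrite rmorphM actFM mulgA.
rewrite exchange_big; apply: eq_bigr => v _.
rewrite big_distrr (exchange_big_dep xpredT) //=; apply: eq_bigr => w _.
by rewrite (big_pred1 (v * w)%g) ?mulrA // => t; rewrite eq_sym.
Qed.

Lemma pairing_proj f z :
  pairing f (proj z) = QW_eval z (fun w => f (min_rep w)) 1%g.
Proof.
rewrite /pairing /QW_eval (partition_big (@min_rep n) xpredT) //=.
apply: eq_bigr => v _; rewrite ffunE big_distrl.
by apply: eq_bigr => w /eqP <-; rewrite actF1 mul1g.
Qed.

(** The functions on W generated by constants and the u |-> u (x_i) - x_j.  They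
    have values in S, and they are stable under D because a divided difference
    obeys a twisted Leibniz rule and sends these generators to constants. *)
Inductive tautological : (W -> F) -> Prop :=
| taut_const a : tautological (fun=> toF a)
| taut_root i j : tautological (fun u => toF (root (u^-1%g i) j))
| taut_add g h : tautological g -> tautological h ->
    tautological (fun u => g u + h u)
| taut_mul g h : tautological g -> tautological h ->
    tautological (fun u => g u * h u)
| taut_ext g h : g =1 h -> tautological g -> tautological h.

Lemma taut_integral g : tautological g -> forall u, inS (g u).
Proof.
elim=> {g} [a|i j|g h _ IHg _ IHh|g h _ IHg _ IHh|g h gh _ IHg] u.
- by exists a.
- by eexists.
- have [a ->] := IHg u; have [b ->] := IHh u.
  by exists (a + b); rewrite rmorphD.
- have [a ->] := IHg u; have [b ->] := IHh u.
  by exists (a * b); rewrite rmorphM.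
- by rewrite -gh.
Qed.

Lemma taut_shift w g : tautological g -> tautological (fun u => g (u * w)%g).
Proof.
elim=> {g} [a|i j|g h _ IHg _ IHh|g h _ IHg _ IHh|g h gh _ IHg].
- exact: taut_const.
- apply: taut_ext (taut_root (w^-1%g i) j) => u.
  by rewrite invMg permM.
- exact: taut_add.
- exact: taut_mul.
- by apply: taut_ext IHg => u; apply: gh.
Qed.

Lemma taut_prod (I : Type) (r : seq I) (P : pred I) (gs : I -> W -> F) :
  (forall m, P m -> tautological (gs m)) ->
  tautological (fun u => \prod_(m <- r | P m) gs m u).
Proof.
move=> tg; elim: r => [|m r IHr].
  by apply: taut_ext (taut_const 1) => u; rewrite big_nil tofrac1.
case Pm: (P m).
  by apply: taut_ext (taut_mul (tg m Pm) IHr) => u; rewrite big_cons Pm.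
by apply: taut_ext IHr => u; rewrite big_cons Pm.
Qed.

Lemma taut_actS s : tautological (fun u => toF (actS u s)).
Proof.
elim/mpoly_induction: s => [c|m|a b IHa IHb|a b IHa IHb].
- by apply: taut_ext (taut_const c%:MP) => u; rewrite actSC.
- pose i := widen_ord (leqnSn n) m; pose j := lift ord0 m.
  apply: taut_ext (taut_add (taut_root i ord0)
    (taut_mul (taut_const (-1)) (taut_root j ord0))) => u.
  rewrite [in RHS]actSX -[in RHS](root_eltB _ ord0) [in RHS]rmorphB.
  by rewrite rmorphN1 mulN1r.
- by apply: taut_ext (taut_add IHa IHb) => u; rewrite !rmorphD.
- by apply: taut_ext (taut_mul IHa IHb) => u; rewrite !rmorphM.
Qed.

(** The divided difference of u |-> u (x_k) - x_l is 1, -1 or 0, according as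
    k is i, j or another index. *)
Lemma taut_divdiff i j g : i != j -> tautological g ->
  tautological
    (fun u => (g u - g (u * tperm i j)%g) / toF (root (u^-1%g i) (u^-1%g j))).
Proof.
move=> ij; elim=> {g} [a|k l|g h tg IHg th IHh|g h tg IHg th IHh|g h gh _ IHg].
- by apply: taut_ext (taut_const 0) => u; rewrite subrr mul0r tofrac0.
- have r0 u : toF (root (u^-1%g i) (u^-1%g j)) != 0.
    by rewrite tofrac_eq0 root_elt_neq0 // (inj_eq perm_inj).
  pose c : S := (k == i)%:R - (k == j)%:R.
  apply: taut_ext (taut_const c) => u.
  rewrite -tofracB invMg permM tpermV root_eltB /c.
  case: tpermP => [->|->|/eqP ki /eqP kj].
  + by rewrite eqxx (negPf ij) mulr1n mulr0n subr0 tofrac1 divff.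
  + rewrite eqxx eq_sym (negPf ij) mulr1n mulr0n sub0r rmorphN1.
    by rewrite -root_eltN tofracN mulNr divff.
  + by rewrite root_elt_ii (negPf ki) (negPf kj) mulr0n subrr tofrac0 mul0r.
- by apply: taut_ext (taut_add IHg IHh) => u; ring.
- apply: taut_ext (taut_add (taut_mul IHg th)
    (taut_mul (taut_shift (tperm i j) tg) IHh)) => u.
  by ring.
- by apply: taut_ext IHg => u; rewrite !gh.
Qed.

Lemma QW_eval_X i j g u : QW_eval (X_root R i j) g u
  = (g u - g (u * tperm i j)%g) / toF (root (u^-1%g i) (u^-1%g j)).
Proof.
rewrite QW_evalM QW_eval_delta mulg1 QW_evalB !QW_eval_delta mulg1.
by rewrite fmorphV /= actF_toF /= actS_root rmorph1 !mul1r mulrC.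
Qed.

Lemma taut_QW_eval z g : inD z -> tautological g -> tautological (QW_eval z g).
Proof.
move=> Dz.
elim: Dz g => {z} [s|i j ij|z1 z2 _ IH1 _ IH2|z1 z2 _ IH1 _ IH2] g tg.
- apply: taut_ext (taut_mul (taut_actS s) tg) => u.
  by rewrite QW_eval_delta actF_toF mulg1.
- by apply: taut_ext (taut_divdiff ij tg) => u; rewrite QW_eval_X.
- by apply: taut_ext (taut_add (IH1 g tg) (IH2 g tg)) => u; rewrite QW_evalD.
- by apply: taut_ext (IH1 _ (IH2 g tg)) => u; rewrite QW_evalM.
Qed.

Lemma inS_inQ x : inS x -> inQ x.
Proof.
by case=> a ->; exists a, [::]; rewrite big_nil tofrac1 divr1.
Qed.

(** Functions on cosets are not stable under right translation, which is why
    tautological functions live on all of W. *)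
Lemma taut_DPstar f : tautological (fun w => f (min_rep w)) -> inDPstar f.
Proof.
move=> tf; split=> [v|_ [z Dz ->]]; last first.
  by rewrite pairing_proj; apply/taut_integral/taut_QW_eval.
by rewrite -(coset_indexK v); apply: inS_inQ; apply: taut_integral tf _.
Qed.

(** Up to sign, the product of the weights of the tangent space of P^n at j. *)
Definition euler_class j : S := \prod_(l | l != j) root j l.

Lemma euler_class_neq0 j : euler_class j != 0.
Proof. by apply/prodf_neq0 => l; rewrite eq_sym; apply: root_elt_neq0. Qed.

Definition point_class j : QWP_dual :=
  [ffun v => if coset_index v == j then toF (euler_class j) else 0].

(** pt_j is the restriction of prod_(l <> j) (h - x_l), where h takes the value
    x_i at i; each factor is tautological. *)
Lemma point_class_DPstar j : inDPstar (point_class j).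
Proof.
apply: taut_DPstar; have tr l : l != j ->
    tautological (fun u => toF (root (u^-1%g ord0) l)).
  by move=> _; apply: taut_root.
apply: taut_ext (taut_prod (index_enum _) tr) => u.
rewrite ffunE coset_index_min_rep -rmorph_prod.
case: eqP => [->//|/eqP uj].
by apply/eqP; rewrite tofrac_eq0; apply/prodf_eq0;
   exists (u^-1%g ord0); rewrite ?root_elt_ii.
Qed.

Lemma QW_mul_delta q1 q2 w1 w2 :
  QW_mul (QW_delta q1 w1) (QW_delta q2 w2)
  = QW_delta (q1 * actF w1 q2) (w1 * w2)%g :> QW.
Proof.
apply/ffunP => u; rewrite !ffunE (bigD1 w1) //=.
rewrite [X in _ + X]big1 ?addr0; last first.
  by move=> v vw; apply: big1 => w _; rewrite !ffunE (negPf vw) mul0r.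
case: eqP => [->|/eqP uw].
  rewrite (bigD1 w2) //= !ffunE !eqxx big1 ?addr0 // => w /andP[_ /negPf ww].
  by rewrite !ffunE ww rmorph0 mulr0.
apply: big1 => w /eqP wu; rewrite !ffunE; case: (w =P w2) => [ww|_].
  by rewrite -wu ww eqxx in uw.
by rewrite rmorph0 mulr0.
Qed.

Lemma QW_mul_scalar q z : QW_mul (QW_delta q 1%g) z = [ffun u => q * z u].
Proof.
apply/ffunP => u; rewrite !ffunE (bigD1 1%g) //=.
rewrite [X in _ + X]big1 ?addr0; last first.
  by move=> v v1; apply: big1 => w _; rewrite !ffunE (negPf v1) mul0r.
by rewrite (big_pred1 u) => [|w]; rewrite ?mul1g // !ffunE eqxx actF1.
Qed.

(** W is generated by reflections, and delta_s = 1 - alpha X_alpha for the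
    reflection s in alpha. *)
Lemma inD_delta w : inD (QW_delta 1 w : QW).
Proof.
have inD_one : inD (QW_delta 1 1%g : QW) by rewrite -tofrac1; apply: inD_S.
have [ts -> /allP dts] := prod_tpermP w.
elim: ts dts => [|[i j] ts IHts] dts; first by rewrite big_nil.
rewrite big_cons /=.
have ij : i != j by apply: (dts (i, j)); rewrite mem_head.
rewrite (_ : QW_delta _ _ = QW_mul (QW_delta 1 (tperm i j))
   (QW_delta 1 (\prod_(t <- ts) tperm t.1 t.2)%g)); last first.
  by rewrite QW_mul_delta rmorph1 mulr1.
apply: inD_mul; last first.
  by apply: IHts => t t_ts; apply: dts; rewrite inE t_ts orbT.
rewrite (_ : QW_delta _ _ = QW_delta 1 1%g
   + QW_mul (QW_delta (toF (- root i j)) 1%g) (X_root R i j)).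
  by apply: inD_add => //; apply: inD_mul; [apply: inD_S | apply: inD_X].
have r0 : toF (root i j) != 0 by rewrite tofrac_eq0 root_elt_neq0.
rewrite /X_root !QW_mul_scalar; apply/ffunP => u; rewrite !ffunE rmorphN mulNr.
by rewrite mulVKf // opprB addrC subrK.
Qed.

Lemma DPstar_integral f (v : WP_quot n) : inDPstar f -> inS (f v).
Proof.
case=> _ /(_ (proj (QW_delta 1 (val v)))).
rewrite pairing_proj QW_eval_delta rmorph1 mul1r mul1g.
rewrite (_ : min_rep (val v) = v).
  by apply; exists (QW_delta 1 (val v)) => //; apply: inD_delta.
by apply/eqP; rewrite min_rep_eq.
Qed.

End Module.

(** * Reducing fractions modulo a prime ideal *)

Section Residue.

Local Open Scope ring_scope.
Variables (A : idomainType) (k : fieldType) (phi : {rmorphism A -> k}).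
Local Notation F := {fraction A}.
Local Notation toF := (@tofrac A).

(** The residue map of the localization of A at the kernel of phi, as a relation
    so that fractions outside the localization need no value. *)
Definition residue (x : F) (y : k) : Prop :=
  exists a b, [/\ phi b != 0, x = toF a / toF b & y = phi a / phi b].

Lemma toF_neq0 b : phi b != 0 -> toF b != 0.
Proof. by rewrite tofrac_eq0; apply: contraNneq => ->; rewrite rmorph0. Qed.

Lemma residue_uniq x y1 y2 : residue x y1 -> residue x y2 -> y1 = y2.
Proof.
move=> [a1 [b1 [b1P -> ->]]] [a2 [b2 [b2P /eqP + ->]]].
rewrite eqr_div ?toF_neq0 // -!tofracM tofrac_eq => /eqP/(congr1 phi).
by rewrite !rmorphM => e; apply/eqP; rewrite eqr_div // e.
Qed.

Lemma residue_toF a : residue (toF a) (phi a).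
Proof. by exists a, 1; rewrite rmorph1 oner_eq0 tofrac1 !divr1. Qed.

Lemma residue0 : residue 0 0.
Proof. by rewrite -tofrac0 -(rmorph0 phi); apply: residue_toF. Qed.

Lemma residue1 : residue 1 1.
Proof. by rewrite -tofrac1 -(rmorph1 phi); apply: residue_toF. Qed.

Lemma residueD x1 y1 x2 y2 :
  residue x1 y1 -> residue x2 y2 -> residue (x1 + x2) (y1 + y2).
Proof.
move=> [a1 [b1 [b1P -> ->]]] [a2 [b2 [b2P -> ->]]].
exists (a1 * b2 + a2 * b1), (b1 * b2).
by rewrite !(rmorphM, rmorphD) /= mulf_neq0 // !addf_div ?toF_neq0.
Qed.

Lemma residueM x1 y1 x2 y2 :
  residue x1 y1 -> residue x2 y2 -> residue (x1 * x2) (y1 * y2).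
Proof.
move=> [a1 [b1 [b1P -> ->]]] [a2 [b2 [b2P -> ->]]].
by exists (a1 * a2), (b1 * b2); rewrite !rmorphM /= mulf_neq0 // !mulf_div.
Qed.

Lemma residueB x1 y1 x2 y2 :
  residue x1 y1 -> residue x2 y2 -> residue (x1 - x2) (y1 - y2).
Proof.
move=> h1 h2; rewrite -[- x2]mulN1r -[- y2]mulN1r.
apply/(residueD h1)/residueM => //.
by rewrite -(rmorphN1 phi) -(rmorphN1 toF); apply: residue_toF.
Qed.

Lemma residue_sum (I : Type) (r : seq I) (P : pred I)
    (xs : I -> F) (ys : I -> k) :
  (forall i, residue (xs i) (ys i)) ->
  residue (\sum_(i <- r | P i) xs i) (\sum_(i <- r | P i) ys i).
Proof.
move=> h; apply: (big_ind2 residue) => //; [exact: residue0 | exact: residueD].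
Qed.

Lemma residue_prod (I : Type) (r : seq I) (P : pred I)
    (xs : I -> F) (ys : I -> k) :
  (forall i, residue (xs i) (ys i)) ->
  residue (\prod_(i <- r | P i) xs i) (\prod_(i <- r | P i) ys i).
Proof.
move=> h; apply: (big_ind2 residue) => //; [exact: residue1 | exact: residueM].
Qed.

Lemma residue_det m (X : 'M[F]_m) (Y : 'M[k]_m) :
  (forall i j, residue (X i j) (Y i j)) -> residue (\det X) (\det Y).
Proof.
move=> h; apply: residue_sum => s; apply: residueM; last exact: residue_prod.
rewrite -[(-1) ^+ s](rmorph_sign toF).
rewrite -[(-1) ^+ s in X in residue _ X](rmorph_sign phi).
exact: residue_toF.
Qed.

Lemma residue_neq0 x y : residue x y -> y != 0 -> x != 0.
Proof.
move=> h; apply: contra => /eqP x0; rewrite x0 in h.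
by rewrite (residue_uniq h residue0).
Qed.

(** If Y = 0 then det (1 - X) has residue 1, so 1 - X is invertible, while
    X (1 - X) = 0; if Y = 1 then X itself is invertible. *)
Lemma idempotent_of_residue m (X : 'M[F]_m) (Y : 'M[k]_m) :
  (forall i j, residue (X i j) (Y i j)) -> X *m X = X ->
  (Y = 0 -> X = 0) /\ (Y = 1%:M -> X = 1%:M).
Proof.
move=> h XX; split=> Y_eq; subst Y.
  have uX : 1%:M - X \in unitmx.
    rewrite unitmxE unitfE.
    apply: (@residue_neq0 _ (\det (1%:M - 0 : 'M[k]_m))).
      2: by rewrite subr0 det1 oner_eq0.
    apply: residue_det => i j; rewrite !mxE.
    have := h i j; rewrite mxE => hij; apply: residueB => //.
    case: (i == j); rewrite ?mulr1n ?mulr0n.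
      exact: residue1.
    exact: residue0.
  by rewrite -[LHS](mulmxK uX) mulmxBr mulmx1 XX subrr mul0mx.
have uX : X \in unitmx.
  by rewrite unitmxE unitfE (residue_neq0 (residue_det h)) // det1 oner_eq0.
by rewrite -[LHS](mulmxK uX) XX mulmxV.
Qed.

End Residue.

(** * Idempotents in the group algebra of a finite field *)

Section Circulant.

Local Open Scope ring_scope.
Variables (k : finFieldType) (p n : nat) (pcharFp : p \in [pchar k]).
Variables (c : 'I_n.+1 -> k) (c' : k -> 'I_n.+1).
Hypotheses (cK : cancel c c') (c'K : cancel c' c).

Lemma shift_inj d : injective (fun i => c' (c i + d)).
Proof. by move=> i j /(can_inj c'K) /addIr /(can_inj cK). Qed.

Definition shift d : 'S_n.+1 := perm (@shift_inj d).

Lemma shiftE d i : c (shift d i) = c i + d.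
Proof. by rewrite permE c'K. Qed.

Lemma shiftD d1 d2 : (shift d1 * shift d2)%g = shift (d1 + d2).
Proof.
by apply/permP => i; apply: (can_inj cK); rewrite permM !shiftE addrA.
Qed.

Lemma shiftX d m : (shift d ^+ m)%g = shift (d *+ m).
Proof.
elim: m => [|m IHm].
  apply/permP => i; apply: (can_inj cK).
  by rewrite expg0 perm1 shiftE mulr0n addr0.
by rewrite expgS IHm shiftD mulrS.
Qed.

(** The matrices invariant under all translations form the group algebra of
    (k, +).  By the Frobenius identity for commuting elements, Y^p is
    sum_d a_d^p P_d^p, where P_d^p = P_(p d) = 1; hence Y = Y^p is scalar. *)
Lemma circulant_idempotent (Y : 'M[k]_n.+1) :
  (forall d i j, Y (shift d i) (shift d j) = Y i j) -> Y *m Y = Y ->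
  Y = 0 \/ Y = 1%:M.
Proof.
move=> Yshift YY; pose a d := Y ord0 (shift d ord0).
have YE : Y = \sum_d a d *: perm_mx (shift d).
  apply/matrixP => i j; rewrite summxE (bigD1 (c j - c i)) //= big1 => [|d dij].
    rewrite !mxE addr0.
    have -> : shift (c j - c i) i = j.
      by apply: (can_inj cK); rewrite shiftE addrC subrK.
    rewrite eqxx mulr1 /a -(Yshift (c i - c ord0) ord0).
    by congr (Y _ _); apply: (can_inj cK); rewrite !shiftE; ring.
  rewrite !mxE; case: eqP => [ij|_]; last by rewrite mulr0.
  by rewrite -ij shiftE addrC addKr eqxx in dij.
have pcharM : p \in [pchar 'M[k]_n.+1] by rewrite pchar_lalg.
have comm_terms d1 d2 : GRing.comm (a d1 *: perm_mx (shift d1) : 'M_n.+1)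
                                   (a d2 *: perm_mx (shift d2)).
  rewrite /GRing.comm -!scalerAl -!scalerAr !scalerA mulrC.
  by rewrite -!mulmxE -!perm_mxM !shiftD addrC.
have Yp : Y ^+ p = (\sum_d a d ^+ p)%:M.
  rewrite -(pFrobenius_autE pcharM) {1}YE.
  have : forall r : seq k,
      pFrobenius_aut pcharM (\sum_(d <- r) a d *: perm_mx (shift d)) =
      \sum_(d <- r) (a d ^+ p)%:M.
    elim=> [|d r IHr]; first by rewrite !big_nil pFrobenius_aut0.
    rewrite !big_cons pFrobenius_autD_comm; last first.
      by apply: commr_sum => d' _; apply: comm_terms.
    rewrite IHr pFrobenius_autE exprZn; congr (_ + _).
    have permX m :
        perm_mx (shift d) ^+ m = perm_mx (shift (d *+ m)) :> 'M[k]_n.+1.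
      elim: m => [|m IHm].
        by rewrite expr0 -shiftX expg0 perm_mx1.
      by rewrite exprS IHm -mulmxE -perm_mxM shiftD mulrS.
    by rewrite permX -mulr_natr (pcharf0 pcharFp) mulr0 -(mulr0n d) -shiftX
               expg0 perm_mx1 scalemx1.
  by move->; rewrite raddf_sum.
have p_gt0 : (0 < p)%N by rewrite prime_gt0 // (pcharf_prime pcharFp).
have Yscal : Y = (\sum_d a d ^+ p)%:M.
  rewrite -Yp; case: p p_gt0 => // m _.
  by elim: m => [|m IHm]; rewrite ?expr1 // exprS -IHm -mulmxE YY.
move: Yscal YY; set s := \sum_d _ => ->.
rewrite -scalar_mxM => /matrixP/(_ ord0 ord0).
rewrite !mxE eqxx !mulr1n => ss.
have [->|s0] := eqVneq s 0; [left; exact: raddf0 | right].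
by congr _%:M; apply: (mulfI s0); rewrite ss mulr1.
Qed.

End Circulant.

(** * The matrix of an endomorphism *)

Lemma clear_denominator (K : fieldType) (s d t x : K) :
  (x != 0 -> s * d * t = x * d * (t / x * s))%R.
Proof. by move=> x0; field. Qed.

Section Endomorphism.

Variables (R : idomainType) (n : nat).
Local Notation W := 'S_n.+1.
Local Notation S := {mpoly R[n]}.
Local Notation F := {fraction S}.
Local Notation toF := (@tofrac S).
Local Notation root i j := (root_elt R i j).
Local Notation QW := (QW R n).
Local Notation QWP_dual := (QWP_dual R n).
Implicit Types (i j k l : 'I_n.+1) (u w : W) (a b s : S) (x y q : F).
Implicit Types (z : QW) (f : QWP_dual) (v : WP_quot n).
Local Open Scope ring_scope.

Definition scale_dual a f : QWP_dual := [ffun v => toF a * f v].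

Lemma odot_delta q w f v : odot (QW_delta q w) f v
  = q * actF w (f (coset_of_index (w (coset_index v)))).
Proof.
rewrite ffunE (bigD1 w) //= [X in _ + X]big1 ?addr0 => [|u uw]; last first.
  by apply: big1 => v' _; rewrite ffunE (negPf uw) mul0r.
rewrite (big_pred1 (coset_of_index (w (coset_index v)))) => [|v'].
  by rewrite ffunE eqxx.
rewrite /= min_rep_eq invMg permM.
rewrite -(inj_eq (@perm_inj _ w)) permKV.
by rewrite -[RHS](inj_eq (@coset_index_inj n)) coset_of_indexK.
Qed.

Lemma odot_scalar a f : odot (QW_delta (toF a) 1%g) f = scale_dual a f.
Proof.
apply/ffunP => v; rewrite odot_delta ffunE perm1 coset_indexK.
by rewrite actF1.
Qed.

Lemma inSD x y : inS x -> inS y -> inS (x + y).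
Proof. by move=> [a ->] [b ->]; exists (a + b); rewrite tofracD. Qed.

Lemma DPstar0 : inDPstar (0 : QWP_dual).
Proof.
split=> [v|d _].
  by rewrite ffunE; apply: inS_inQ; exists 0; rewrite tofrac0.
by exists 0; rewrite tofrac0; apply: big1 => v _; rewrite ffunE mulr0.
Qed.

Lemma DPstarD f g : inDPstar f -> inDPstar g -> inDPstar (f + g).
Proof.
move=> hf hg; split=> [v|d hd].
  by rewrite ffunE; apply/inS_inQ/inSD; apply: DPstar_integral.
rewrite (_ : pairing _ _ = pairing f d + pairing g d).
  by apply: inSD; [apply: hf.2 | apply: hg.2].
by rewrite /pairing -big_split; apply: eq_bigr => v _; rewrite ffunE mulrDr.
Qed.

Lemma DPstarZ a f : inDPstar f -> inDPstar (scale_dual a f).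
Proof.
move=> hf; split=> [v|d hd].
  rewrite ffunE; apply: inS_inQ; have [b ->] := DPstar_integral v hf.
  by exists (a * b); rewrite tofracM.
have [b fd] := hf.2 d hd; exists (a * b); rewrite tofracM -fd big_distrr.
by apply: eq_bigr => v _; rewrite ffunE mulrCA.
Qed.

Lemma odot_point_class w j :
  odot (QW_delta 1 w) (point_class R j) = point_class R (w^-1%g j).
Proof.
apply/ffunP => v; rewrite odot_delta !ffunE coset_of_indexK mul1r.
rewrite -(inj_eq (@perm_inj _ w) (coset_index v)) permKV.
case: eqP => _; last by rewrite rmorph0.
rewrite actF_toF; congr toF; rewrite rmorph_prod.
rewrite [RHS](reindex_inj (@perm_inj _ w^-1%g)) /=.
apply: eq_big => [l|l _]; first by rewrite (inj_eq perm_inj).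
exact: actS_root.
Qed.

Variable e : QWP_dual -> QWP_dual.
Hypothesis e_endo : DPstar_endomorphism e.

Let e_stable f : inDPstar f -> inDPstar (e f).
Proof. by case: e_endo => + _ _; apply. Qed.

Let eD f g : inDPstar f -> inDPstar g -> e (f + g) = e f + e g.
Proof. by case: e_endo => _ + _; apply. Qed.

Let eZ a f : inDPstar f -> e (scale_dual a f) = scale_dual a (e f).
Proof.
by case: e_endo => _ _ e_odot hf; rewrite -!odot_scalar e_odot //; apply: inD_S.
Qed.

Let e_sum (I : Type) (r : seq I) (fs : I -> QWP_dual) :
  (forall m, inDPstar (fs m)) ->
  inDPstar (\sum_(m <- r) fs m) /\
  e (\sum_(m <- r) fs m) = \sum_(m <- r) e (fs m).
Proof.
move=> hfs; elim: r => [|m r [IHr IHe]].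
  rewrite !big_nil; split; first exact: DPstar0.
  by apply: (addIr (e 0)); rewrite -eD ?addr0 ?add0r //; apply: DPstar0.
by rewrite !big_cons; split; [apply: DPstarD | rewrite eD // IHe].
Qed.

(** The expansion f = sum_j (f j / e_j) pt_j has coefficients in Q, over which e
    is not assumed to be linear; by [endo_mxE] the matrix that it suggests
    computes e nevertheless. *)
Definition endo_mx : 'M[F]_n.+1 := \matrix_(i, j)
  (e (point_class R j) (coset_of_index i) / toF (euler_class R j)).

Let euler_neq0 j : toF (euler_class R j) != 0.
Proof. by rewrite tofrac_eq0 euler_class_neq0. Qed.

Lemma endo_mxE f i : inDPstar f ->
  e f (coset_of_index i) = \sum_j endo_mx i j * f (coset_of_index j).
Proof.
move=> hf.
have [s fs] :=
  fin_all_exists (fun j => DPstar_integral (coset_of_index j) hf).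
(* Multiplying by the product E of all e_j makes the expansion of f in point
   classes one with coefficients in S, where linearity of e applies. *)
pose E : S := \prod_(j < n.+1) euler_class R j.
pose d j : S := \prod_(l | l != j) euler_class R l.
have Ed j : E = euler_class R j * d j by rewrite /E (bigD1 j).
have E0 : toF E != 0.
  by rewrite tofrac_eq0; apply/prodf_neq0 => j _; apply: euler_class_neq0.
have fE : scale_dual E f = \sum_j scale_dual (s j * d j) (point_class R j).
  apply/ffunP => v; rewrite -(coset_indexK v) ffunE fs sum_ffunE.
  rewrite (bigD1 (coset_index v)) //= !ffunE coset_of_indexK eqxx.
  rewrite big1 ?addr0 => [|j vj].
    by rewrite -!tofracM (Ed (coset_index v)); congr toF; ring.
  by rewrite !ffunE coset_of_indexK eq_sym (negPf vj) mulr0.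
have hpt j : inDPstar (scale_dual (s j * d j) (point_class R j)).
  by apply: DPstarZ; apply: point_class_DPstar.
have [_] := e_sum (index_enum _) hpt.
rewrite -fE eZ // => /ffunP /(_ (coset_of_index i)).
rewrite ffunE sum_ffunE => eE; apply: (mulfI E0); rewrite eE big_distrr.
apply: eq_bigr => j _; rewrite eZ ?ffunE; last exact: point_class_DPstar.
rewrite mxE fs (Ed j) !tofracM /=.
exact: (clear_denominator _ _ _ (euler_neq0 j)).
Qed.

Lemma endo_mx_idem :
  (forall f, inDPstar f -> e (e f) = e f) -> endo_mx *m endo_mx = endo_mx.
Proof.
move=> ee; apply/matrixP => i j; rewrite mxE [RHS]mxE -ee.
  2: exact: point_class_DPstar.
rewrite endo_mxE; last exact/e_stable/point_class_DPstar.
by rewrite big_distrl; apply: eq_bigr => l _; rewrite [endo_mx l j]mxE mulrA.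
Qed.

(** delta_w sends pt_j to pt_(w^-1 j), and e commutes with delta_w. *)
Lemma endo_mx_equivariant w i j :
  actF w (endo_mx i j) = endo_mx (w^-1%g i) (w^-1%g j).
Proof.
have [_ _ e_odot] := e_endo.
have := e_odot _ _ (inD_delta R w) (point_class_DPstar R j).
rewrite odot_point_class => /ffunP /(_ (coset_of_index (w^-1%g i))).
rewrite odot_delta coset_of_indexK permKV mul1r => eE.
rewrite !mxE eE rmorphM fmorphV /= actF_toF; congr (_ / toF _).
rewrite rmorph_prod /= [RHS](reindex_inj (@perm_inj _ w^-1%g)) /=.
apply: eq_big => [l|l _]; first by rewrite (inj_eq perm_inj).
exact: actS_root.
Qed.

(** The denominators of e (pt_j), an element of D_P^*, and of the inverse of e_j
    are products of roots. *)
Lemma endo_mx_inQ i j : inQ (endo_mx i j).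
Proof.
rewrite mxE; have [a [r [r_roots ->]]] := (e_stable (point_class_DPstar R j)).1
  (coset_of_index i).
exists a, (r ++ [seq (j, l) | l <- enum (predC1 j)]); split.
  rewrite all_cat r_roots; apply/allP => _ /mapP[l + ->].
  by rewrite mem_enum inE /= eq_sym.
rewrite big_cat big_map tofracM invfM mulrA; congr (_ / toF _).
by rewrite big_enum.
Qed.

End Endomorphism.

(** * The point of Spec Q fixed by translations *)

Section Main.

Local Open Scope ring_scope.
Variables (R : idomainType) (n p : nat) (k : finFieldType).
Variable iota : {rmorphism R -> k}.
Hypotheses (pcharFp : p \in [pchar k]) (card_k : #|k| = n.+1).
Local Notation S := {mpoly R[n]}.
Local Notation F := {fraction S}.

(* c i is the value given to x_i: every element of k is taken once. *)
Let c (i : 'I_n.+1) : k := enum_val (cast_ord (esym card_k) i).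
Let c' (t : k) : 'I_n.+1 := cast_ord card_k (enum_rank t).

Let cK : cancel c c'.
Proof. by move=> i; rewrite /c /c' enum_valK cast_ordKV. Qed.
Let c'K : cancel c' c.
Proof. by move=> t; rewrite /c /c' cast_ordK enum_rankK. Qed.

Let ev : S -> k :=
  mmap iota (fun m => c (widen_ord (leqnSn n) m) - c (lift ord0 m)).

HB.instance Definition _ := GRing.RMorphism.copy ev
  (mmap iota (fun m => c (widen_ord (leqnSn n) m) - c (lift ord0 m))).

Let ev_root i j : ev (root_elt R i j) = c i - c j.
Proof.
by apply: (@root_elt_morph _ _ _ ev) => m; rewrite /= /ev mmapX mmap1U.
Qed.

(* Translations change no difference of coordinates. *)
Let ev_act d a : ev (actS (shift cK c'K d) a) = ev a.
Proof.
elim/mpoly_induction: a => [r|m|a b IHa IHb|a b IHa IHb].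
- by rewrite actSC.
- rewrite -root_elt_simple actS_root !ev_root.
  set w := shift _ _ _; have cw i : c (w^-1%g i) = c i - d.
    by rewrite -{2}(permKV w i) shiftE addrK.
  by rewrite !cw; ring.
- by rewrite !rmorphD /= IHa IHb.
- by rewrite !rmorphM /= IHa IHb.
Qed.

Lemma residue_inQ (x : F) : inQ x -> exists y, residue ev x y.
Proof.
case=> a [r [r_roots ->]]; eexists; exists a; eexists; split=> //.
rewrite rmorph_prod prodf_seq_neq0; apply: sub_all r_roots => ij ij_neq /=.
by rewrite ev_root subr_eq0 (inj_eq (can_inj cK)).
Qed.

Lemma residue_shift d (x : F) y :
  residue ev x y -> residue ev (actF (shift cK c'K d) x) y.
Proof.
case=> a [b [b0 -> ->]].
exists (actS (shift cK c'K d) a), (actS (shift cK c'K d) b).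
rewrite /= !ev_act actF_frac //; apply: contraNneq b0 => ->.
by rewrite rmorph0.
Qed.

(** The ring morphism from R to a field with n + 1 elements provides the point of
    Spec Q at which the matrix of an idempotent is reduced. *)
Theorem DPstar_indecomposable_of_finite_field : DPstar_indecomposable R n.
Proof.
move=> e e_endo ee; have Mee := endo_mx_idem e_endo ee.
have [Yf Yres] := fin_all_exists (fun ij : 'I_n.+1 * 'I_n.+1 =>
  residue_inQ (endo_mx_inQ e_endo ij.1 ij.2)).
pose Y : 'M[k]_n.+1 := \matrix_(i, j) Yf (i, j).
have res i j : residue ev (endo_mx e i j) (Y i j).
  by rewrite [Y i j]mxE; apply: (Yres (i, j)).
have YY : Y *m Y = Y.
  apply/matrixP => i j; apply: residue_uniq (res i j).
  rewrite -{1}Mee [(Y *m Y) i j]mxE [(endo_mx e *m _) i j]mxE.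
  by apply: residue_sum => l; apply: residueM; apply: res.
have Yshift d i j : Y (shift cK c'K d i) (shift cK c'K d j) = Y i j.
  apply: residue_uniq _ (res i j).
  have := residue_shift d (res (shift cK c'K d i) (shift cK c'K d j)).
  by rewrite endo_mx_equivariant // !permK.
have [M0 M1] := idempotent_of_residue res Mee.
have e_val f v : inDPstar f -> e f v
    = \sum_j endo_mx e (coset_index v) j * f (coset_of_index j).
  by move=> hf; rewrite -{1}(coset_indexK v) endo_mxE.
have [/M0 M_eq|/M1 M_eq] := circulant_idempotent pcharFp Yshift YY;
  [left | right];
  move=> f hf; apply/ffunP => v; rewrite e_val // M_eq.
  by rewrite ffunE big1 // => j _; rewrite mxE mul0r.
rewrite (bigD1 (coset_index v)) //= mxE eqxx mul1r coset_indexK.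
rewrite big1 ?addr0 // => j; rewrite eq_sym => /negPf vj.
by rewrite mxE vj mul0r.
Qed.

End Main.

Theorem proposition7p1 (p r n : nat) (p_prime : prime p) (r_ge1 : 1 <= r)
    (n_def : n = p ^ r - 1) :
  DPstar_indecomposable int n /\ DPstar_indecomposable 'F_p n.
Proof.
have [k pchark card_k] := pPrimePowerField p_prime r_ge1.
have card_k' : #|k| = n.+1.
  by rewrite card_k n_def subn1 prednK // expn_gt0 prime_gt0.
split.
  exact: (@DPstar_indecomposable_of_finite_field int n p k intr).
(* [pPrimeCharType] is k itself, with its structure of F_p-algebra. *)
exact: (@DPstar_indecomposable_of_finite_field 'F_p n p
  (pPrimeCharType pchark) (in_alg _) pchark card_k').
Qed.
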